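(* Let $(\Omega,T)$ denote the Fibonacci subshift. If $\alpha=\frac12(\sqrt5-1)$ denotes the inverse of the golden mean, then $$\mathfrak A(\Omega,T)=\mathbb Z[\alpha].$$
   Context: $\mathbb T=\mathbb R/\mathbb Z$. Let $\mathcal A=\{0,1\}$ and let $S$ be the substitution $S(0)=01$, $S(1)=0$, extended to finite words by concatenation; put $u_n=S^n(0)$. The Fibonacci subshift is $\Omega=\{\omega\in\mathcal A^{\mathbb Z}:\text{for every finite interval } I\subseteq\mathbb Z,\ \omega|_I\text{ is a subword of some }u_n\}$, with $[T\omega](n)=\omega(n+1)$. It is strictly ergodic (minimal and uniquely ergodic). Here $\mathbb Z[\alpha]$ is the subring of $\mathbb R$ generated by $\mathbb{Z}$ and $\alpha$. For a compact metric space $\Omega$, homeomorphism $T:\Omega\to\Omega$ and $T$-ergodic Borel probability measure $\mu$: the suspension is $X=(\Omega\times\mathbb R)/\!\sim$, where $(\omega,t)\sim(\omega',t')$ iff $(\omega',t')=(T^n\omega,t-n)$ for some $n\in\mathbb Z$, with classes $[\omega,t]$, flow $\overline T^{t}[\omega,s]=[\omega,s+t]$, and $\overline T$-ergodic measure $\overline\mu$ given by $\int_X g\,d\overline\mu=\int_0^1\int_\Omega g[\omega,s]\,d\mu(\omega)\,ds$. $C^\sharp(X,\mathbb T)$ is the group of homotopy classes of continuous maps $X\to\mathbb T$ (pointwise addition). For $\phi\in C(X,\mathbb T)$, $x\in X$, let $\widetilde\phi_x:\mathbb R\to\mathbb R$ be a continuous lift of $t\mapsto\phi(\overline T^{t}x)$.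 For $\overline\mu$-a.e. $x$, $\lim_{t\to\infty}\widetilde\phi_x(t)/t$ exists and equals a constant depending only on $[\phi]$, denoted $\mathfrak A_{\overline\mu}([\phi])$ (the Schwartzman homomorphism). $\mathfrak A(\Omega,T,\mu)=\mathfrak A_{\overline\mu}(C^\sharp(X,\mathbb T))\subseteq\mathbb R$ is its range; when $(\Omega,T)$ is uniquely ergodic one writes $\mathfrak A(\Omega,T)$. *)

(* Defs.v *)
From HB Require Import structures.
From mathcomp Require Import all_boot all_order all_algebra.
From mathcomp Require Import generic_quotient zify.
From mathcomp Require Import all_classical all_reals all_analysis.
Import Order.TTheory GRing.Theory Num.Theory.
Import numFieldNormedType.Exports.

Set Implicit Arguments.
Unset Strict Implicit.
Unset Printing Implicit Defensive.

Local Open Scope classical_set_scope.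
Local Open Scope ring_scope.
Local Open Scope quotient_scope.

Record homeo (X : topologicalType) := Homeo {
  homeo_fun :> X -> X;
  homeo_inv : X -> X;
  homeo_funK : cancel homeo_fun homeo_inv;
  homeo_invK : cancel homeo_inv homeo_fun;
  homeo_fun_cts : continuous homeo_fun;
  homeo_inv_cts : continuous homeo_inv }.

Definition iterz (X : topologicalType) (T : homeo X) (n : int) : X -> X :=
  match n with
  | Posz k => iter k T
  | Negz k => iter k.+1 (homeo_inv T)
  end.

Section iterz_theory.
Context (X : topologicalType) (T : homeo X).

Lemma iterzS (n : int) x : iterz T (n + 1) x = T (iterz T n x).
Proof.
case: n => [n|n].
  by rewrite (_ : Posz n + 1 = Posz n.+1)//; lia.
case: n => [|n]; first by rewrite (_ : Negz 0 + 1 = 0)//= homeo_invK.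
by rewrite (_ : Negz n.+1 + 1 = Negz n) /= ?homeo_invK//; lia.
Qed.

Lemma iterzP (n : int) x : iterz T (n - 1) x = homeo_inv T (iterz T n x).
Proof. by rewrite -[in RHS](subrK 1 n) iterzS homeo_funK. Qed.

Lemma iterzD (m n : int) x : iterz T (m + n) x = iterz T m (iterz T n x).
Proof.
elim/int_ind: m => [|m IH|m IH]; first by rewrite add0r.
  by rewrite -addn1 PoszD addrAC !iterzS IH.
by rewrite -addn1 PoszD opprD addrAC !iterzP IH.
Qed.

End iterz_theory.

Section circle.
Context (R : realType).

Definition circle_rel (x y : R) : bool := `[< exists n : int, y = x + n%:~R >].

Lemma circle_rel_refl : reflexive circle_rel.
Proof. by move=> x; apply/asboolP; exists 0; rewrite addr0. Qed.

Lemma circle_rel_sym : symmetric circle_rel.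
Proof.
suff H x y : circle_rel x y -> circle_rel y x by move=> x y; apply/idP/idP => /H.
by move=> /asboolP[n ->]; apply/asboolP; exists (- n); rewrite intrN addrK.
Qed.

Lemma circle_rel_trans : transitive circle_rel.
Proof.
move=> y x z /asboolP[n ->] /asboolP[m ->]; apply/asboolP; exists (n + m).
by rewrite intrD addrA.
Qed.

Canonical circle_equiv :=
  EquivRel circle_rel circle_rel_refl circle_rel_sym circle_rel_trans.

Definition circle : topologicalType := quotient_topology {eq_quot circle_equiv}.

Definition circle_pi (x : R) : circle := \pi_{eq_quot circle_equiv} x.

End circle.

Section suspension.
Context (R : realType) (Omega : ptopologicalType) (T : homeo Omega).

Definition susp_rel (p q : Omega * R) : bool :=
  `[< exists n : int, q = (iterz T n p.1, p.2 - n%:~R) >].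

Lemma susp_rel_refl : reflexive susp_rel.
Proof. by move=> [w s]; apply/asboolP; exists 0; rewrite subr0. Qed.

Lemma susp_rel_sym : symmetric susp_rel.
Proof.
suff H p q : susp_rel p q -> susp_rel q p by move=> p q; apply/idP/idP => /H.
case: p => w s /asboolP[n ->]; apply/asboolP; exists (- n) => /=.
by rewrite -iterzD addNr intrN opprK subrK.
Qed.

Lemma susp_rel_trans : transitive susp_rel.
Proof.
move=> q [w s] r /asboolP[n ->] /asboolP[m ->]; apply/asboolP; exists (m + n).
by rewrite /= iterzD intrD opprD addrA addrAC.
Qed.

Canonical susp_equiv :=
  EquivRel susp_rel susp_rel_refl susp_rel_sym susp_rel_trans.

Definition suspension : Type := quotient_topology {eq_quot susp_equiv}.

HB.instance Definition _ := Topological.on suspension.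
HB.instance Definition _ :=
  isPointed.Build suspension (\pi_{eq_quot susp_equiv} (point, 0)).

Definition susp_pi (w : Omega) (s : R) : suspension :=
  \pi_{eq_quot susp_equiv} (w, s).

Definition susp_flow (t : R) (x : suspension) : suspension :=
  let p := repr (x : {eq_quot susp_equiv}) in susp_pi p.1 (p.2 + t).

Lemma susp_flowE (t : R) (w : Omega) (s : R) :
  susp_flow t (susp_pi w s) = susp_pi w (s + t).
Proof.
rewrite /susp_flow /susp_pi; case: piP => -[w' s'] /= /eqmodP/asboolP[n /= [-> ->]].
by apply/esym/eqmodP/asboolP; exists n; rewrite addrAC.
Qed.

End suspension.

Definition borel (X : ptopologicalType) := g_sigma_algebraType (@open X).

Section homotopy.
Context (R : realType) (X Y : topologicalType).

Definition homotopic (f g : X -> Y) : Prop :=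
  exists H : X * R -> Y,
    [/\ {within [set p | p.2 \in `[0, 1]], continuous H},
        forall x, H (x, 0) = f x & forall x, H (x, 1) = g x].

Definition homotopy_class (f : X -> Y) : set (X -> Y) :=
  [set g | continuous g /\ homotopic f g].

Definition homotopy_classes : set (set (X -> Y)) :=
  [set homotopy_class f | f in [set f : X -> Y | continuous f]].

End homotopy.

Section schwartzman.
Context (R : realType) (Omega : ptopologicalType) (T : homeo Omega).
Local Notation X := (suspension R T).

Definition ergodic (mu : probability (borel Omega) R) : Prop :=
  (forall A : set (borel Omega), measurable A -> mu (T @^-1` A) = mu A) /\
  (forall A : set (borel Omega), measurable A -> T @^-1` A = A ->
     mu A = 0%E \/ mu A = 1%E).

(* The identity for integrals against the suspension measure, read on
   indicator functions of Borel sets. *)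
Definition susp_measure (mu : probability (borel Omega) R)
    (B : set (borel X)) : \bar R :=
  (\int[@lebesgue_measure R]_(s in `[0%R, 1%R])
    \int[mu]_w (\1_B (susp_pi T w s))%:E)%E.

Definition Csharp : set (set (X -> circle R)) :=
  @homotopy_classes R X (circle R).

Definition orbit_lift (phi : X -> circle R) (x : X) (f : R -> R) : Prop :=
  continuous f /\ forall t, circle_pi (f t) = phi (susp_flow t x).

Definition has_winding (phi : X -> circle R) (x : X) (c : R) : Prop :=
  exists2 f : R -> R, orbit_lift phi x f & f t / t @[t --> +oo] --> c.

(* The value is the number c such that every representative of the class h has
   winding c almost everywhere. *)
Definition schwartzman (mu : probability (borel Omega) R)
    (h : set (X -> circle R)) : R :=
  get [set c : R | forall phi, h phi ->
    {ae susp_measure mu, forall x : borel X, has_winding phi x c}].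

Definition schwartzman_range (mu : probability (borel Omega) R) : set R :=
  schwartzman mu @` Csharp.

End schwartzman.

(* The letters 0 and 1 are false and true. *)
Definition fib_letter (a : bool) : seq bool :=
  if a then [:: false] else [:: false; true].

Definition fib_subst (w : seq bool) : seq bool := flatten (map fib_letter w).

Definition fib_word (n : nat) : seq bool := iter n fib_subst [:: false].

Definition full_shift : topologicalType := {ptws int -> bool}.

Definition window (w : int -> bool) (a : int) (n : nat) : seq bool :=
  [seq w (a + i%:Z) | i <- iota 0 n].

Definition fib_set : set full_shift :=
  [set w | forall (a : int) (n : nat), exists k, infix (window w a n) (fib_word k)].

(* Nonemptiness of the subshift, needed for the pointed structure. *)
Section fib_point.

Lemma fib_subst_cat s t : fib_subst (s ++ t) = fib_subst s ++ fib_subst t.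
Proof. by rewrite /fib_subst map_cat flatten_cat. Qed.

Lemma fib_wordSS n : fib_word n.+2 = fib_word n.+1 ++ fib_word n.
Proof.
elim: n => // n IH.
transitivity (fib_subst (fib_word n.+1 ++ fib_word n)); first by rewrite -IH.
by rewrite fib_subst_cat.
Qed.

Lemma size_fib_word n : (n < size (fib_word n))%N.
Proof.
suff: ((n < size (fib_word n)) && (n.+1 < size (fib_word n.+1)))%N by case/andP.
elim: n => // n /andP[h1 h2]; rewrite h2 fib_wordSS size_cat; lia.
Qed.

Lemma nth_fib_word n m j : (n <= m)%N -> (j < size (fib_word n))%N ->
  nth false (fib_word m) j = nth false (fib_word n) j.
Proof.
move=> /subnKC <-; elim: (m - n)%N => [|d IH] hj; first by rewrite addn0.
rewrite addnS -(IH hj).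
have hd : (j < size (fib_word (n + d)))%N.
  elim: d {IH} => [|d IH]; first by rewrite addn0.
  rewrite addnS; apply: leq_trans IH _; case: (n + d)%N => // k.
  by rewrite fib_wordSS size_cat leq_addr.
by move: hd; case: (n + d)%N => [|k] hd; [case: j hd {hj IH}|rewrite fib_wordSS nth_cat hd].
Qed.

Lemma nth_rev_fib_word n m j : (n <= m)%N -> (j < size (fib_word n.*2))%N ->
  nth false (rev (fib_word m.*2)) j = nth false (rev (fib_word n.*2)) j.
Proof.
move=> /subnKC <-; elim: (m - n)%N => [|d IH] hj; first by rewrite addn0.
rewrite addnS -(IH hj) doubleS fib_wordSS rev_cat nth_cat size_rev ifT//.
elim: d {IH} => [|d IH]; first by rewrite addn0.
by rewrite addnS doubleS fib_wordSS size_cat; apply: leq_trans IH (leq_addl _ _).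
Qed.

Definition fib_pt : full_shift := fun z : int =>
  match z with
  | Posz j => nth false (fib_word j) j
  | Negz j => nth false (rev (fib_word j.*2)) j
  end.

Lemma fib_ptE (K : nat) (i : nat) : let L := size (fib_word K.*2) in
  (L - K <= i < L + K)%N ->
  fib_pt (i%:Z - L%:Z) = nth false (fib_word K.*2 ++ fib_word K.*2) i.
Proof.
move=> L /andP[hi1 hi2]; have hL : (K.*2 < L)%N by exact: size_fib_word.
rewrite nth_cat -/L; case: ltnP => hi.
- have -> : i%:Z - L%:Z = Negz (L - i.+1) by lia.
  have hj : (L - i.+1 < size (fib_word (L - i.+1).*2))%N.
    by apply: leq_trans (size_fib_word _); lia.
  rewrite /= -(@nth_rev_fib_word _ K)//; last by lia.
  by rewrite nth_rev -/L; [congr nth; lia | lia].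
- have -> : i%:Z - L%:Z = Posz (i - L) by lia.
  by rewrite /= (@nth_fib_word (i - L)%N K.*2)//; [lia | exact: size_fib_word].
Qed.

Lemma fib_set_pt : fib_set fib_pt.
Proof.
move=> a n; pose K := (absz a + n)%N; pose L := size (fib_word K.*2).
have hL : (K.*2 < L)%N by exact: size_fib_word.
exists K.*2.+3; pose v := fib_word K.*2 ++ fib_word K.*2.
pose o := absz (a + L%:Z).
have oE : o%:Z = a + L%:Z by rewrite /o; lia.
have szv : size v = (L + L)%N by rewrite size_cat.
have -> : window fib_pt a n = take n (drop o v).
  apply: (@eq_from_nth _ false).
    rewrite size_map size_iota size_take size_drop szv; case: ltnP => //; lia.
  move=> i; rewrite size_map size_iota => hi.
  rewrite (nth_map 0%N) ?size_iota// nth_iota// add0n nth_take// nth_drop.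
  rewrite -(@fib_ptE K) -/L; last by lia.
  by congr fib_pt; lia.
have h1 : infix (take n (drop o v)) v.
  by apply: infix_trans (infix_drop _ _); exact: infix_take.
apply: infix_trans h1 _; rewrite /v fib_wordSS (fib_wordSS K.*2).
case: K.*2 => [|k]; first by [].
rewrite [X in infix _ (_ ++ X)]fib_wordSS -catA.
by apply/infixP; exists (fib_word k.+2), (fib_word k); rewrite !catA.
Qed.

End fib_point.

Definition fib_space : Type := set_type fib_set.

HB.instance Definition _ := Topological.on fib_space.
HB.instance Definition _ :=
  isPointed.Build fib_space (exist _ fib_pt (mem_set fib_set_pt)).

Section fib_shift.

Lemma fib_set_translate (w : full_shift) (b : int) :
  fib_set w -> fib_set (fun n => w (n + b)).
Proof.
move=> hw a n; have [k hk] := hw (a + b) n; exists k.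
rewrite (_ : window _ _ _ = window w (a + b) n)//.
by apply: eq_map => i; rewrite addrAC.
Qed.

Definition fib_translate (b : int) (w : fib_space) : fib_space :=
  exist _ (fun n => set_val w (n + b))
    (mem_set (fib_set_translate b (set_mem (valP w)))).

Lemma fib_translateK (b c : int) : b + c = 0 ->
  cancel (fib_translate b) (fib_translate c).
Proof.
move=> bc w; apply: val_inj; apply/funext => n.
have -> : \val (fib_translate c (fib_translate b w)) n = \val w (n + c + b).
  by [].
by rewrite -addrA [c + b]addrC bc addr0.
Qed.

Lemma fib_translate_cts (b : int) : continuous (fib_translate b).
Proof.
apply: continuous_comp_initial => w.
have FF : Filter ((set_val \o fib_translate b) x @[x --> w]).
  exact/fmap_filter/nbhs_filter.
apply/cvg_sup => n U [_ [[B oB <-] Bw] BU].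
have h : nbhs w ((fun v : fib_space => set_val v (n + b)) @^-1` B).
  apply: (@continuous_comp _ _ _ (set_val : fib_space -> full_shift)
    (fun f : full_shift => f (n + b)) w).
  - exact: initial_continuous.
  - exact: (@proj_continuous int (fun=> bool) (n + b)).
  - exact: open_nbhs_nbhs.
by apply: filterS h => v Bv; exact: BU.
Qed.

Definition fib_shift : homeo fib_space :=
  Homeo (fib_translateK (subrr 1)) (fib_translateK (addNr 1))
    (@fib_translate_cts 1) (@fib_translate_cts (-1)).

End fib_shift.

Definition int_adjoin (R : realType) (a : R) : set R :=
  smallest (fun S : set R => subring_closed [in S]) (range intr `|` [set a]).

(* Main.v *)
(** A continuous map phi : X -> T pulls back to a map g(w, s) = phi [w, s] on
    Omega x R.  Since Omega is compact and totally disconnected, g(w, 0) has a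
    bounded lift theta(w), and the increments over unit time of the lifts along
    the orbits are, up to the coboundary of theta, integers depending only on a
    finite window of w.  So the rotation number of phi is governed by sums of a
    block function nu along w.  Every window of w occurs in the infinite
    Fibonacci word x, and the sums of nu along x over the lengths |u_k|
    eventually satisfy the Fibonacci recursion, as do |u_k| and the number of
    ones of u_k, which together span the integer solutions.  Hence the sums of
    nu along x up to n are p n + q #ones(n) + O(1) for some integers p, q, and
    #ones(n) = (1 - alpha) n + O(1).  Every orbit thus has rotation number
    p + q (1 - alpha), in Z[alpha].  Conversely, the map which on [n, n + 1]
    climbs p + q w(n) times around the circle realizes this value.  As winding numbers
    exist and agree on all orbits, the measure plays no role. *)

Require Import Defs.
From mathcomp Require Import all_boot all_order all_algebra.
From mathcomp Require Import generic_quotient zify ring lra.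
From mathcomp Require Import all_classical all_reals all_analysis.
Import Order.TTheory GRing.Theory Num.Theory.
Import numFieldNormedType.Exports.

Set Implicit Arguments.
Unset Strict Implicit.
Unset Printing Implicit Defensive.

Local Open Scope classical_set_scope.
Local Open Scope ring_scope.
Local Open Scope quotient_scope.

(** * Sums along the infinite Fibonacci word *)

Definition fib_seq (j : nat) : bool := nth false (fib_word j) j.

Lemma fib_seqE K j : (j < size (fib_word K))%N ->
  fib_seq j = nth false (fib_word K) j.
Proof.
move=> jK; have [jleK|/ltnW Klej] := leqP j K.
  by rewrite (nth_fib_word jleK)// size_fib_word.
by rewrite /fib_seq (nth_fib_word Klej).
Qed.

Lemma size_fib_wordSS K :
  size (fib_word K.+2) = (size (fib_word K.+1) + size (fib_word K))%N.
Proof. by rewrite fib_wordSS size_cat. Qed.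

Lemma size_fib_word_mono m n : (m <= n)%N ->
  (size (fib_word m) <= size (fib_word n))%N.
Proof.
apply: (homo_leq leqnn leq_trans (f := fun k => size (fib_word k))) => -[//|K].
by rewrite [leqRHS]size_fib_wordSS leq_addr.
Qed.

(** As u_{K+2} = u_{K+1} u_K, the prefix u_{K+1} of x is followed by u_K, itself a prefix of x. *)
Lemma fib_seq_shift K j : (j < size (fib_word K))%N ->
  fib_seq (size (fib_word K.+1) + j) = fib_seq j.
Proof.
move=> jK; rewrite (@fib_seqE K.+2) ?size_fib_wordSS ?ltn_add2l//.
by rewrite fib_wordSS nth_cat ltnNge leq_addr /= addKn -fib_seqE.
Qed.

(** Thus x begins with the square of u_{K+2} = u_{K+1} u_K: the copy of u_{K+1} after u_{K+2}
    completes u_{K+3}, and the prefix u_{K+3} is again followed by u_K. *)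
Lemma fib_seq_shiftS K j : (j < size (fib_word K.+2))%N ->
  fib_seq (size (fib_word K.+2) + j) = fib_seq j.
Proof.
have [jK _|Kj jK] := ltnP j (size (fib_word K.+1)); first exact: fib_seq_shift.
have [i -> iK] : exists2 i, j = (size (fib_word K.+1) + i)%N &
    (i < size (fib_word K))%N.
  by exists (j - size (fib_word K.+1))%N; move: jK; rewrite size_fib_wordSS; lia.
rewrite [RHS]fib_seq_shift// addnA -size_fib_wordSS fib_seq_shift//.
by apply: leq_trans iK _; apply: size_fib_word_mono; lia.
Qed.

Definition nsum (f : nat -> int) (n : nat) : int := \sum_(0 <= j < n) f j.

Lemma nsumS f n : nsum f n.+1 = nsum f n + f n.
Proof. by rewrite /nsum big_nat_recr. Qed.

Lemma nsumD f m n : nsum f (m + n) = nsum f m + nsum (fun j => f (m + j)%N) n.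
Proof.
elim: n => [|n IH]; first by rewrite addn0 [X in _ + X]big_geq// addr0.
by rewrite addnS !nsumS IH addrA.
Qed.

Lemma eq_nsum f g n : (forall j, (j < n)%N -> f j = g j) -> nsum f n = nsum g n.
Proof. by move=> fg; apply: eq_big_nat => j /andP[_]; exact: fg. Qed.

Definition fib_ones : nat -> int := nsum (fun j => (fib_seq j : nat)%:Z).

Lemma fib_onesD K i : (i <= size (fib_word K))%N ->
  fib_ones (size (fib_word K.+1) + i) = fib_ones (size (fib_word K.+1)) + fib_ones i.
Proof.
move=> iK; rewrite [LHS]nsumD; congr (_ + _); apply: eq_nsum => j ji.
by rewrite fib_seq_shift// (leq_trans ji).
Qed.

Lemma fib_ones_small : (fib_ones 0 = 0) * (fib_ones 1 = 0) * (fib_ones 2 = 1).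
Proof.
have f0 : fib_ones 0 = 0 by rewrite /fib_ones /nsum big_geq.
have f1 : fib_ones 1 = 0 by rewrite /fib_ones nsumS [nsum _ _]f0.
by split=> //; rewrite /fib_ones nsumS [nsum _ _]f1.
Qed.

(** The matrix of lengths and numbers of ones of two consecutive words has determinant 1 or -1, so
    the coefficients are integers. The induction runs the recursion backwards, from (a, b) to (b -
    a, a). *)
Lemma fib_basis k (a b : int) : exists p q : int,
  a = p * (size (fib_word k))%:Z + q * fib_ones (size (fib_word k)) /\
  b = p * (size (fib_word k.+1))%:Z + q * fib_ones (size (fib_word k.+1)).
Proof.
elim: k a b => [|k IH] a b.
  by exists a, (b - 2 * a); rewrite /= !fib_ones_small; split; lia.
have [p [q [ba ab]]] := IH (b - a) a; exists p, q; split => //.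
rewrite size_fib_wordSS fib_onesD// PoszD !mulrDr.
by rewrite -[b](subrK a) [X in X + _]ba [X in _ + X]ab; ring.
Qed.

Definition fib_block (L j : nat) : seq bool := mkseq (fun l => fib_seq (j + l)) L.

Lemma fib_blockD K L i : (i + L <= size (fib_word K.+2))%N ->
  fib_block L (size (fib_word K.+2) + i) = fib_block L i.
Proof.
move=> iL; apply/eq_in_map => l; rewrite mem_iota /= add0n => lL.
by rewrite -addnA fib_seq_shiftS//; lia.
Qed.

(** Blocks starting before [i] reach past u_{K+1} by less than [L], and |u_K| > K >= L, so they stay
    inside the repeated copy of u_{K+2}. *)
Lemma nsum_fib_blockD (nu : seq bool -> int) L K i : (L <= K)%N ->
  (i <= size (fib_word K.+1))%N ->
  nsum (nu \o fib_block L) (size (fib_word K.+2) + i) =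
  nsum (nu \o fib_block L) (size (fib_word K.+2)) + nsum (nu \o fib_block L) i.
Proof.
move=> LK iK; rewrite nsumD; congr (_ + _); apply: eq_nsum => j ji.
rewrite /comp fib_blockD// size_fib_wordSS.
by have := size_fib_word K; lia.
Qed.

(* Blocks of length L do not see the boundary between long Fibonacci words, so
   both sides obey the same recursion along the lengths of these words. *)
Lemma nsum_fib_block_bounded (nu : seq bool -> int) L : exists p q B : int,
  forall i, `|nsum (nu \o fib_block L) i - (p * i%:Z + q * fib_ones i)| <= B.
Proof.
pose S := nsum (nu \o fib_block L); pose u K := size (fib_word K).
have [p [q [pq0 pq1]]] := fib_basis L.+1 (S (u L.+1)) (S (u L.+2)).
pose E i := S i - (p * i%:Z + q * fib_ones i).
(* The choice of [p] and [q] makes the error [E] vanish at two consecutive lengths; additivity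
   propagates this to all later lengths. *)
have EA K i : (L <= K)%N -> (i <= u K.+1)%N -> E (u K.+2 + i)%N = E (u K.+2) + E i.
  move=> LK iK; rewrite /E /S /u nsum_fib_blockD// fib_onesD// PoszD.
  by rewrite -/(u K.+2); ring.
have E0 K : E (u (L.+1 + K)%N) = 0.
  suff : E (u (L.+1 + K)%N) = 0 /\ E (u (L.+2 + K)%N) = 0 by case.
  elim: K => [|K [IH1 IH2]].
    by rewrite !addn0 /E [S (u L.+1)]pq0 [S (u L.+2)]pq1; split; rewrite subrr.
  rewrite !addnS -!addSn; split => //; move: IH1 IH2; rewrite !addSn => IH1 IH2.
  have -> : u (L + K).+3 = (u (L + K).+2 + u (L + K).+1)%N by exact: size_fib_wordSS.
  by rewrite EA ?leq_addr// IH1 IH2 addr0.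
have ED K i : (L <= K)%N -> (i <= u K.+1)%N -> E (u K.+2 + i)%N = E i.
  move=> LK iK; have := E0 (K - L).+1; rewrite addnS addSn subnKC// => E0K.
  by rewrite EA// E0K add0r.
(* Removing lengths |u_k| preserves [E], so every index reduces to one at most |u_{L+2}|, and the
   sum dominates each such term. *)
exists p, q, (\sum_(0 <= i < (u L.+2).+1) `|E i|) => i; rewrite -/S -/(E i).
have [K iK] : exists K, (i <= u (L.+2 + K))%N.
  by exists i; have := size_fib_word (L.+2 + i); rewrite /u; lia.
elim/ltn_ind: K i iK => -[_|K IH] i iK.
  rewrite addn0 in iK; rewrite (bigD1_seq i) ?iota_uniq ?mem_index_iota//=.
  by rewrite lerDl sumr_ge0.
have [iK'|Ki] := leqP i (u (L.+2 + K)%N); first exact: (IH K).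
have uE : u (L.+2 + K.+1)%N = (u (L + K).+2 + u (L + K).+1)%N.
  by rewrite addnS !addSn; exact: size_fib_wordSS.
have [j ij jK] : exists2 j, i = (u (L + K).+2 + j)%N & (j <= u (L + K).+1)%N.
  by exists (i - u (L + K).+2)%N; move: iK Ki; rewrite uE !addSn; lia.
rewrite ij ED ?leq_addr//; case: K IH {Ki iK ij uE} jK => [|K] IH jK.
  apply: (IH 0%N) => //; rewrite addn0; apply: leq_trans jK _; rewrite addn0.
  exact: size_fib_word_mono.
by apply: (IH K) => //; rewrite !addSn -addnS.
Qed.

(** * The golden mean and the frequency of ones *)

Section golden.
Context (R : realType).

Definition golden : R := (Num.sqrt 5 - 1) / 2.

Lemma golden_sqr : golden ^+ 2 = 1 - golden.
Proof.
have s5 : Num.sqrt 5 ^+ 2 = 5 :> R by rewrite sqr_sqrtr.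
by rewrite /golden; field: s5.
Qed.

Lemma golden_ge0 : 0 <= golden.
Proof. by rewrite divr_ge0// subr_ge0 -[leLHS]sqrtr1 ler_sqrt// ler1n. Qed.

Lemma golden_le1 : golden <= 1.
Proof. by have := sqr_ge0 golden; rewrite golden_sqr subr_ge0. Qed.

(** Since - alpha is a root of X^2 = X + 1, its powers obey the Fibonacci recursion, as do the other
    terms; it remains to compare two initial values. *)
Lemma fib_ones_size K : (fib_ones (size (fib_word K)))%:~R =
  (1 - golden) * (size (fib_word K))%:R - golden ^+ 2 * (- golden) ^+ K :> R.
Proof.
pose P K := (fib_ones (size (fib_word K)))%:~R =
  (1 - golden) * (size (fib_word K))%:R - golden ^+ 2 * (- golden) ^+ K :> R.
suff : P K /\ P K.+1 by case.
have g2 := golden_sqr.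
elim: K => [|K [IH1 IH2]]; rewrite /P.
  rewrite /= !fib_ones_small expr0 expr1; split; first by rewrite g2; ring.
  by ring: g2.
split=> //; rewrite size_fib_wordSS fib_onesD// intrD IH1 IH2 natrD !exprS.
by ring: g2.
Qed.

(** Peeling prefixes u_k off the word of length [i] leaves a geometric series of errors. *)
Lemma fib_ones_bounded i :
  `|(fib_ones i)%:~R - (1 - golden) * i%:R| <= 2 :> R.
Proof.
have [[g0 g1] g2] := (golden_ge0, golden_le1, golden_sqr).
have gX K : 0 <= golden ^+ K by rewrite exprn_ge0.
(* The term alpha^K makes the induction close: peeling u_{K+1} costs alpha^(K+3), and alpha^(K+3) +
   alpha^(K+2) = alpha^(K+1) <= alpha^K. *)
suff H K : forall j, (j <= size (fib_word K))%N ->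
    `|(fib_ones j)%:~R - (1 - golden) * j%:R| <= 2 - golden ^+ K.
  by apply: le_trans (H i i _) _; [exact/ltnW/size_fib_word|rewrite gerBl].
elim/ltn_ind: K => -[|[|K]] IH j.
- case: j => [|[|//]] _; rewrite fib_ones_small expr0.
    by rewrite mulr0 subr0 normr0; lra.
  by rewrite mulr1 sub0r normrN ger0_norm; lra.
- case: j => [|[|[|//]]] _; rewrite fib_ones_small expr1 ler_norml; lra.
- have [jK _|Kj jK] := leqP j (size (fib_word K.+1)).
    apply: le_trans (IH K.+1 _ j jK) _ => //.
    by rewrite lerD2l lerN2 [leLHS]exprS ler_piMl.
  have [i' -> iK] : exists2 i, j = (size (fib_word K.+1) + i)%N &
      (i <= size (fib_word K))%N.
    by exists (j - size (fib_word K.+1))%N; move: jK; rewrite size_fib_wordSS; lia.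
  rewrite fib_onesD// intrD natrD.
  have := IH K _ i' iK; have := fib_ones_size K.+1.
  set a := (fib_ones i')%:~R; set b := _%:~R; set c := _%:R; set d := _%:R.
  move=> bE /(_ (leqnSn _)) ad.
  have -> : b + a - (1 - golden) * (c + d) =
      (a - (1 - golden) * d) - golden ^+ 2 * (- golden) ^+ K.+1 by rewrite bE; ring.
  apply: le_trans (ler_normB _ _) _.
  rewrite normrM !normrX normrN (ger0_norm g0).
  have -> : golden ^+ K.+2 = golden ^+ K * (1 - golden) by rewrite !exprS; ring: g2.
  have -> : golden ^+ 2 * golden ^+ K.+1 = golden ^+ K * (2 * golden - 1).
    by rewrite !exprS; ring: g2.
  have : 0 <= golden ^+ K * (1 - golden) by rewrite mulr_ge0// subr_ge0.
  by move: ad; lra.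
Qed.

End golden.

(** * Lifts of circle-valued maps *)

Section circle_theory.
Context (R : realType).
Implicit Types (x e : R) (a b c : circle R).

Lemma intr_lt1_eq0 (n : int) : `|n%:~R : R| < 1 -> n = 0.
Proof. by rewrite -intr_norm -[1]/(1%:~R) ltr_int; lia. Qed.

Lemma near_dist x e : 0 < e -> \forall x' \near x, `|x - x'| < e.
Proof. by move=> e0; exact: (nbhsx_ballx x e). Qed.

Lemma frac_itv x : 0 <= x - (Num.floor x)%:~R <= 1.
Proof.
by rewrite subr_ge0 floor_le_tmp/= lerBlDl -intrD1 ltW// floorD1_gt.
Qed.

Lemma circle_piP x y :
  circle_pi x = circle_pi y <-> exists n : int, y = x + n%:~R.
Proof.
split; first by move=> /eqmodP/asboolP.
by move=> xy; apply/eqmodP/asboolP.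
Qed.

Lemma circle_piDint x (n : int) : circle_pi (x + n%:~R) = circle_pi x.
Proof. by apply/esym/circle_piP; exists n. Qed.

Lemma circle_pi01 a : exists2 x, circle_pi x = a & 0 <= x < 1.
Proof.
pose x := repr (a : {eq_quot circle_equiv R}).
exists (x - (Num.floor x)%:~R).
  by rewrite -intrN circle_piDint /circle_pi reprK.
by rewrite subr_ge0 floor_le_tmp ltrBlDl -intrD1 floorD1_gt.
Qed.

Lemma circle_pi_continuous : continuous (@circle_pi R).
Proof. exact: pi_continuous. Qed.

(** Arc distance less than [e], expressed through lifts because [circle] carries only the quotient
    topology. *)
Definition close e a b :=
  exists x d, [/\ circle_pi x = a, circle_pi (x + d) = b & `|d| < e].

Lemma close_pil e x b : close e (circle_pi x) b ->
  exists2 d, circle_pi (x + d) = b & `|d| < e.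
Proof.
case=> y [d [/circle_piP[n ->] <- de]]; exists d => //.
by rewrite addrAC circle_piDint.
Qed.

Lemma close_pi e x y : close e (circle_pi x) (circle_pi y) ->
  exists n : int, `|y - x - n%:~R| < e.
Proof.
move=> /close_pil[d /circle_piP[n ->] de]; exists n.
by rewrite (_ : _ - _ = d)//; ring.
Qed.

Lemma close_sym e a b : close e a b -> close e b a.
Proof.
by case=> x [d [xa xb de]]; exists (x + d), (- d); rewrite addrK normrN.
Qed.

Lemma close_trans e1 e2 a b c : close e1 a b -> close e2 b c ->
  close (e1 + e2) a c.
Proof.
case=> x [d [xa xb de1]]; rewrite -xb => /close_pil[d' xc de2].
exists x, (d + d'); rewrite addrA; split => //.
by rewrite (le_lt_trans (ler_normD _ _))// ltrD.
Qed.

Lemma close_le e1 e2 a b : e1 <= e2 -> close e1 a b -> close e2 a b.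
Proof.
by move=> e12 [x [d [? ? de]]]; exists x, d; split=> //; exact: lt_le_trans e12.
Qed.

Lemma close_refl e a : 0 < e -> close e a a.
Proof.
by move=> e0; have [x xa _] := circle_pi01 a; exists x, 0; rewrite addr0 normr0.
Qed.

Lemma nbhs_close e a : 0 < e -> nbhs a (close e a).
Proof.
move=> e0; have [x <- _] := circle_pi01 a.
apply: open_nbhs_nbhs; split; last exact: close_refl.
suff : open (@circle_pi R @^-1` (close e (circle_pi x)) : set R) by [].
rewrite openE => y /= [z [d [/circle_piP[n zx] /circle_piP[m yd] de]]].
have dE : d = y - (x + (m - n)%:~R) by rewrite yd zx intrB; ring.
near=> y'; exists (x + (m - n)%:~R), (y' - (x + (m - n)%:~R)).
rewrite circle_piDint subrKC; split => //.
have : `|y - y'| < e - `|d|.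
  by near: y'; apply: near_dist; rewrite subr_gt0.
rewrite dE ltrBrDr; apply: le_lt_trans.
by rewrite (distrC y y') ler_distD.
Unshelve. all: by end_near. Qed.

(* Intermediate value theorem: a path cannot jump between neighbourhoods of
   different integers. *)
Lemma near_int_confined (h : R -> R) e : continuous h -> e <= 1 / 2 ->
  (forall t, exists n : int, `|h t - n%:~R| < e) -> `|h 0| < e ->
  forall t, `|h t| < e.
Proof.
move=> hc e2 hint h0 t; rewrite ltNge; apply/negP => et.
pose k (s : R) : R := `|h (s * t)|.
have kc : continuous k.
  have htc : continuous (fun s : R => h (s * t)).
    by move=> s; apply: continuous_comp; [exact: mulrr_continuous|exact: hc].
  by move=> s; apply: cvg_norm; exact: htc.
have [|||s _ ks] := @IVT R k 0 1 e.
- exact: ler01.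
- exact: continuous_subspaceT.
- rewrite /k mul0r mul1r ge_min le_max et orbT andbT; apply/orP; left; exact: ltW.
(* Where |h| equals [e] exactly, the nearby integer has absolute value below 2 e <= 1, hence is 0,
   which contradicts the strict bound. *)
have [n hn] := hint (s * t).
have n0 : n = 0.
  apply: intr_lt1_eq0; have := ler_normD (n%:~R - h (s * t)) (h (s * t)).
  rewrite subrK distrC -/(k s) ks; move: hn e2; lra.
by move: hn; rewrite n0 subr0 -/(k s) ks ltxx.
Qed.

(** At each point there is only one lift of [gam] within 1/4 of [h0], and this rigidity makes the
    pointwise choice continuous. *)
Lemma lift_perturb (Y : topologicalType) (h0 : Y -> R) (gam : Y -> circle R) :
  continuous h0 -> continuous gam ->
  (forall y, close (1 / 4) (circle_pi (h0 y)) (gam y)) ->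
  exists h : Y -> R, [/\ continuous h, forall y, circle_pi (h y) = gam y &
    forall y, `|h y - h0 y| < 1 / 4].
Proof.
move=> h0c gamc h0gam.
have /choice[d dP] : forall y, exists d, circle_pi (h0 y + d) = gam y /\ `|d| < 1 / 4.
  by move=> y; have [d ? ?] := close_pil (h0gam y); exists d.
pose h y := h0 y + d y; have hgam y : circle_pi (h y) = gam y := (dP y).1.
have hh0 y : `|h y - h0 y| < 1 / 4 by rewrite /h addrAC subrr add0r (dP y).2.
exists h; split => // y; apply/cvgrPdist_lt => e e0; near=> z.
have : close (Num.min e (1 / 8)) (gam y) (gam z).
  near: z; apply: gamc; apply: nbhs_close; rewrite lt_min e0/=; lra.
rewrite -!hgam => /close_pi[n].
have : `|h0 y - h0 z| < 1 / 8.
  by near: z; apply: (cvgr_dist_lt _ _ (h0c y)); lra.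
rewrite lt_min => yz0 /andP[yze yz8].
suff n0 : n = 0 by move: yze; rewrite n0 subr0 distrC.
(* Here |n| < 1/4 + 1/8 + 1/4 + 1/8. *)
apply: intr_lt1_eq0; move: (hh0 y) (hh0 z) yz0 yz8; rewrite !ltr_norml; lra.
Unshelve. all: by end_near. Qed.

(** Stage [n] lifts the path frozen outside [- n d, n d]. Consecutive frozen paths are 1/4-close, so
    each lift is a perturbation of the previous one, starting from a constant, and the stages
    stabilize on bounded sets. *)
Lemma path_lift (gam : R -> circle R) (d : R) : 0 < d -> continuous gam ->
  (forall s s', `|s - s'| <= d -> close (1 / 4) (gam s) (gam s')) ->
  exists2 f : R -> R, continuous f & forall t, circle_pi (f t) = gam t.
Proof.
move=> d0 gamc gamd.
pose clamp (n : nat) (t : R) := Num.max (- (n%:R * d)) (Num.min t (n%:R * d)).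
have clampc n : continuous (clamp n).
  move=> t; apply: (@continuous_max _ _ (cst (- (n%:R * d)))
    (fun t => Num.min t (n%:R * d))); first exact: cst_continuous.
  by apply: (@continuous_min _ _ id (cst (n%:R * d)));
    [exact: cvg_id|exact: cst_continuous].
have clampE n t : `|t| <= n%:R * d -> clamp n t = t.
  by rewrite ler_norml /clamp => /andP[? ?]; rewrite (min_idPl _)// (max_idPr _).
have clampS n t : `|clamp n t - clamp n.+1 t| <= d.
  have nd : 0 <= n%:R * d by rewrite mulr_ge0// ltW.
  rewrite /clamp -natr1 mulrDl mul1r; move: (n%:R * d) nd => D D0.
  by rewrite /Num.max /Num.min; do 4? case: ifPn => //; rewrite -?leNgt ler_norml; lra.
have [x0 x00 _] := circle_pi01 (gam 0).
(* The hypotheses of [lift_perturb] are premises of [Q], so that [choice] yields a total operator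
   [Phi], with an arbitrary value where they fail. *)
pose Q (hg : (R -> R) * (R -> circle R)) (h : R -> R) :=
  continuous hg.1 -> continuous hg.2 ->
  (forall y, close (1 / 4) (circle_pi (hg.1 y)) (hg.2 y)) ->
  [/\ continuous h, forall y, circle_pi (h y) = hg.2 y &
    forall y, `|h y - hg.1 y| < 1 / 4].
have /choice[Phi PhiP] : forall hg, exists h, Q hg h.
  move=> hg; have [hgP|hgNP] := pselect [/\ continuous hg.1, continuous hg.2 &
    forall y, close (1 / 4) (circle_pi (hg.1 y)) (hg.2 y)].
    by case: hgP => hc gc cl; have [h hP] := lift_perturb hc gc cl; exists h.
  by exists hg.1 => ? ? ?; exfalso; apply: hgNP.
pose F := fix F n := if n is m.+1 then Phi (F m, gam \o clamp m.+1) else cst x0.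
have gclamp n : continuous (gam \o clamp n).
  by move=> t; apply: continuous_comp; [exact: clampc|exact: gamc].
have FP n : continuous (F n) /\ forall t, circle_pi (F n t) = gam (clamp n t).
  elim: n => [|n [Fc Fg]].
    split; first exact: cst_continuous.
    move=> t; rewrite /= x00 /clamp mul0r oppr0; congr gam.
    by rewrite /Num.max /Num.min; do 2? case: ifPn; rewrite -?leNgt; lra.
  have FgS t : close (1 / 4) (circle_pi (F n t)) (gam (clamp n.+1 t)).
    by rewrite Fg; exact: gamd.
  by case: (PhiP (F n, gam \o clamp n.+1) Fc (gclamp n.+1) FgS).
have FS n t : `|F n.+1 t - F n t| < 1 / 4.
  have [Fc Fg] := FP n.
  have FgS s : close (1 / 4) (circle_pi (F n s)) (gam (clamp n.+1 s)).
    by rewrite Fg; exact: gamd.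
  by have [_ _ h] := PhiP (F n, gam \o clamp n.+1) Fc (gclamp n.+1) FgS; exact: h.
(* Where neither clamp acts, consecutive stages lift the same point and differ by less than 1/4, so
   they agree. *)
have Fstab n m t : `|t| <= n%:R * d -> F (n + m)%N t = F n t.
  move=> tn; elim: m => [|m <-]; first by rewrite addn0.
  rewrite addnS; have [_ F1] := FP (n + m)%N; have [_ F2] := FP (n + m).+1.
  have le1 : n%:R * d <= (n + m)%:R * d by rewrite ler_pM2r// ler_nat leq_addr.
  have le2 : n%:R * d <= (n + m).+1%:R * d by rewrite ler_pM2r// ler_nat; lia.
  have /circle_piP[k kE] : circle_pi (F (n + m)%N t) = circle_pi (F (n + m).+1 t).
    by rewrite F1 F2 !clampE//; [exact: le_trans le2|exact: le_trans le1].
  suff k0 : k = 0 by rewrite kE k0 addr0.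
  apply: intr_lt1_eq0; have := FS (n + m)%N t; rewrite kE addrAC subrr add0r; lra.
pose N (t : R) := (Num.trunc (`|t| / d)).+1.
have NP t : `|t| <= (N t)%:R * d.
  by rewrite -ler_pdivrMr// ltW// truncnS_gt.
have FN n t : `|t| <= n%:R * d -> F (N t) t = F n t.
  move=> tn; have [le|/ltnW le] := leqP (N t) n; first by rewrite -(subnKC le) Fstab.
  by rewrite -(subnKC le) Fstab.
exists (fun t => F (N t) t) => t; last by rewrite (FP _).2 clampE.
(* The stage chosen for |t| + 1 computes the limit at every point within distance 1 of [t], which
   gives continuity there. *)
have [Fc _] := FP (N (`|t| + 1)).
have tN : `|t| + 1 <= (N (`|t| + 1))%:R * d by rewrite -[leLHS]ger0_norm// addr_ge0.
apply/cvgrPdist_lt => e e0; near=> s.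
rewrite !(FN (N (`|t| + 1))).
- by near: s; exact: (cvgr_dist_lt _ _ (Fc t)).
- apply: le_trans tN.
  have : `|t - s| < 1 by near: s; exact: near_dist.
  have := lerB_dist s t; rewrite distrC; lra.
- by apply: le_trans tN; rewrite lerDl.
Unshelve. all: by end_near. Qed.

(** Near-covering along d -> 0+ makes the local continuity estimates of [g] uniform over [C]; the
    second point may leave [C]. *)
Lemma compact_modulus (Z : topologicalType) (C : set (Z * R))
    (g : Z * R -> circle R) e : compact C -> continuous g -> 0 < e ->
  exists2 d, 0 < d &
    forall z s s', C (z, s) -> `|s - s'| <= d -> close e (g (z, s)) (g (z, s')).
Proof.
move=> /compact_near_coveringP Cnc gc e0.
pose P d (p : Z * R) :=
  forall s', `|p.2 - s'| <= d -> close e (g p) (g (p.1, s')).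
have : \forall d \near 0^'+, C `<=` P d.
  apply: Cnc => -[z s] _.
  have e20 : 0 < e / 2 by rewrite divr_gt0.
  have [[A B] [/= nA /nbhs_ballP[r /= r0 rB]] AB] :=
    gc (z, s) _ (nbhs_close (g (z, s)) e20).
  have r20 : 0 < r / 2 by rewrite divr_gt0.
  exists ((A `*` ball s (r / 2)), [set d | d < r / 2]) => /=.
    split; first by exists (A, ball s (r / 2)) => //; split => //; exact: nbhsx_ballx.
    exact: nbhs_right_lt.
  move=> [[z' s'] d] /= [[Az' ss'] dr] s'' s's''.
  have ss'' : B s''.
    apply: rB; move: ss'; rewrite /ball /= => ss'.
    by have := ler_distD s' s s''; lra.
  have Bs' : B s' by apply: rB; move: ss'; rewrite /ball /=; lra.
  rewrite [e]splitr; apply: (@close_trans _ _ _ (g (z, s))).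
    exact/close_sym/(AB (z', s')).
  exact: (AB (z', s'')).
move=> /filterI/(_ (nbhs_right_gt (0 : R)))/filter_ex[d [dC d0]].
by exists d => // z s s' Czs; exact: (dC (z, s)).
Qed.

End circle_theory.

(** * The Fibonacci subshift *)

Section fib_topology.

Definition agree (M : nat) (v w : fib_space) : Prop :=
  forall n : int, (absz n <= M)%N -> set_val v n = set_val w n.

Lemma cvg_fib (F : set_system fib_space) (w : fib_space) : Filter F ->
  (forall n, F [set v | set_val v n = set_val w n]) -> F --> w.
Proof.
move=> FF Fw U [_ [[B oB <-] Bw] BU].
suff : F (set_val @^-1` B) by exact: filterS BU.
have : (set_val @ F) --> (set_val w : full_shift).
  apply/cvg_sup => n V [_ [[C _ <-] Cw] CV].
  change (F (set_val @^-1` V)); apply: filterS (Fw n) => v /= vw.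
  by apply: CV; rewrite /= vw.
by apply; exact: open_nbhs_nbhs.
Qed.

(** The central cylinders around [w] generate a filter in which every coordinate is eventually
    constant, so it converges to [w]. *)
Lemma nbhs_agree (w : fib_space) U : nbhs w U ->
  exists M, forall v, agree M v w -> U v.
Proof.
move=> wU; pose F := filter_from [set: nat] (fun M => [set v | agree M v w]).
have FF : Filter F.
  apply: filter_from_filter; first by exists 0%N.
  move=> M N _ _; exists (maxn M N) => // v vw.
  by split=> n nM; apply: vw; rewrite leq_max nM ?orbT.
have Fw n : F [set v | set_val v n = set_val w n].
  by exists (absz n) => // v; apply.
by have [M _ MU] := cvg_fib FF Fw wU; exists M.
Qed.

Lemma nbhs_coord (w : fib_space) n :
  nbhs w [set v | set_val v n = set_val w n].
Proof.
have : nbhs (set_val w : full_shift) [set f | f n = set_val w n].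
  apply: (@proj_continuous int (fun=> bool) n (set_val w) [set set_val w n]).
  exact: discrete_set1.
exact: (@initial_continuous _ _ (set_val : fib_space -> full_shift) w).
Qed.

Lemma nbhs_agreeE M (w : fib_space) : nbhs w [set v | agree M v w].
Proof.
suff : nbhs w [set v | forall n, (n < M.+1)%N ->
    set_val v n%:Z = set_val w n%:Z /\ set_val v (- n%:Z) = set_val w (- n%:Z)].
  apply: filterS => v vw n nM.
  have [np nn] := vw (absz n) nM.
  by have [->|->] : n = (absz n)%:Z \/ n = - (absz n)%:Z by lia.
elim: M.+1 => [|m IH]; first by near=> v.
near=> v => n; rewrite ltnS leq_eqVlt => /predU1P[->|]; last by move: n; near: v.
by split; near: v; exact: nbhs_coord.
Unshelve. all: by end_near. Qed.

Lemma filter_window (F : set_system fib_space) (p : int -> bool) a n :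
  Filter F -> (forall n, F [set v | set_val v n = p n]) ->
  F [set v | window (set_val v) a n = window p a n].
Proof.
move=> FF Fp; rewrite /window; elim: iota => [|i s IH] /=; first exact: filterE.
by apply: filterS2 IH (Fp (a + i%:Z)) => v /= -> ->.
Qed.

(** An ultrafilter decides every letter. The limit sequence lies in the subshift because each of its
    windows is a window of some point. *)
Lemma fib_compact : compact [set: fib_space].
Proof.
rewrite compact_ultra => F FU _.
pose p n := `[< F [set v | set_val v n = true] >].
have Fp n : F [set v | set_val v n = p n].
  rewrite /p; case: asboolP => // FnN.
  have [//|] := in_ultra_setVsetC [set v | set_val v n = true] FU.
  by apply: filterS => v /=; case: (set_val v n).
have pfib : fib_set p.
  move=> a n; have [v <-] := filter_ex (@filter_window F p a n _ Fp).
  exact: (set_mem (valP v)).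
exists (exist _ p (mem_set pfib)); split => //.
exact: cvg_fib.
Qed.

End fib_topology.

Lemma continuous_pair (X Y Z : topologicalType) (f : X -> Y) (h : X -> Z) :
  continuous f -> continuous h -> continuous (fun x => (f x, h x)).
Proof.
move=> fc hc x.
exact: (@cvg_pair _ _ _ _ (nbhs (f x)) (nbhs (h x)) _ _ _ f h (fc x) (hc x)).
Qed.

(** * Translates and windows *)

Lemma fib_translateD (a b : int) (w : fib_space) :
  fib_translate a (fib_translate b w) = fib_translate (a + b) w.
Proof.
apply: val_inj; apply/funext => n.
by rewrite [LHS]/(set_val w (n + a + b)) [RHS]/(set_val w (n + (a + b))) addrA.
Qed.

Lemma fib_translate0 (w : fib_space) : fib_translate 0 w = w.
Proof.
by apply: val_inj; apply/funext => n; rewrite [LHS]/(set_val w (n + 0)) addr0.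
Qed.

Lemma windowP (v w : int -> bool) a n : window v a n = window w a n <->
  forall i, (i < n)%N -> v (a + i%:Z) = w (a + i%:Z).
Proof.
split=> [/eq_in_map vw i|vw]; first by move=> ilt; apply: vw; rewrite mem_iota.
by apply/eq_in_map => i; rewrite mem_iota add0n => /andP[_]; exact: vw.
Qed.

Lemma agreeP M (v w : fib_space) : agree M v w <->
  window (set_val v) (- M%:Z) M.*2.+1 = window (set_val w) (- M%:Z) M.*2.+1.
Proof.
rewrite windowP; split=> vw n nM; first by apply: vw; lia.
have -> : n = - M%:Z + (absz (n + M%:Z))%:Z by lia.
by apply: vw; lia.
Qed.

Lemma agree_translate M (v w : fib_space) : agree M.+1 v w ->
  agree M (fib_translate 1 v) (fib_translate 1 w).
Proof. by move=> vw n nM; apply: vw; lia. Qed.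

Lemma agree_le M N (v w : fib_space) : (M <= N)%N -> agree N v w -> agree M v w.
Proof. by move=> MN vw n nM; apply: vw; exact: leq_trans MN. Qed.

(** The window occurs in some u_k, which is a prefix of x; [i0] is the position of the
    occurrence. *)
Lemma fib_set_fib_seq (w : int -> bool) a n : fib_set w ->
  exists i0, forall j, (j < n)%N -> w (a + j%:Z) = fib_seq (i0 + j).
Proof.
move=> /(_ a n)[k /infixP[p [s kE]]]; exists (size p) => j jn.
have szw : size (window w a n) = n by rewrite size_map size_iota.
rewrite (@fib_seqE k); last by rewrite kE !size_cat szw ltn_add2l ltn_addr.
rewrite kE nth_cat ltnNge leq_addr addKn nth_cat szw jn.
by rewrite (nth_map 0%N) ?size_iota// nth_iota.
Qed.

(** * Rotation numbers of equivariant maps *)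

Section rotation.
Context (R : realType).

(** The functional equation of pullbacks from the suspension, where [T w, s] = [w, s + 1]. *)
Definition equivariant (g : fib_space * R -> circle R) : Prop :=
  forall w s, g (fib_shift w, s) = g (w, s + 1).

Definition is_lift (g : fib_space * R -> circle R) (w : fib_space)
    (f : R -> R) : Prop :=
  continuous f /\ forall t, circle_pi (f t) = g (w, t).

(** Bounded deviation, uniform over orbits and lifts: stronger than a limit of averages, and easily
    carried through small perturbations. *)
Definition rotation (g : fib_space * R -> circle R) (c : R) : Prop :=
  exists C, forall w f, is_lift g w f ->
    forall t, 0 <= t -> `|f t - f 0 - c * t| <= C.

Section equivariant_map.
Context (g : fib_space * R -> circle R).
Hypotheses (gc : continuous g) (geq : equivariant g).

Lemma equivariant_translate (n : int) w s :
  g (fib_translate n w, s) = g (w, s + n%:~R).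
Proof.
elim/int_ind: n w s => [|n IH|n IH] w s; first by rewrite fib_translate0 addr0.
  rewrite -addn1 PoszD addrC -fib_translateD.
  by rewrite [LHS]geq IH intrD addrA.
rewrite -addn1 PoszD opprD -[s in LHS](subrK 1) -[LHS]geq.
rewrite [fib_shift _]fib_translateD (_ : 1 + _ = - n%:Z); last by lia.
by rewrite IH intrD intrN addrAC addrA.
Qed.

Lemma orbit_continuous w : continuous (fun s : R => g (w, s)).
Proof.
move=> s; apply: (@continuous_comp _ _ _ (fun s : R => (w, s)) g); last exact: gc.
by apply: continuous_pair => x; [exact: cvg_cst|exact: cvg_id].
Qed.

(** Equivariance moves [s] into [0, 1], where compactness applies. *)
Lemma orbit_modulus : exists2 d : R, 0 < d &
  forall w s s', `|s - s'| <= d -> close (1 / 4) (g (w, s)) (g (w, s')).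
Proof.
have e0 : 0 < 1 / 4 :> R by [].
have [d d0 dP] :=
  compact_modulus (compact_setX fib_compact (@segment_compact R 0 1)) gc e0.
exists d => // w s s' ss'.
rewrite -[s](subrK (Num.floor s)%:~R) -[s'](subrK (Num.floor s)%:~R).
rewrite -!equivariant_translate; apply: dP.
  by split=> //=; rewrite in_itv; exact: frac_itv.
by rewrite opprB addrA subrK.
Qed.

Lemma lift_exists w : exists f, is_lift g w f.
Proof.
have [d d0 dP] := orbit_modulus.
have [f fc fg] := path_lift d0 (@orbit_continuous w) (dP w).
by exists f.
Qed.

Definition clamp (d t : R) : R := Num.max 0 (Num.min t d).

Lemma clamp_continuous d : continuous (clamp d).
Proof.
move=> t; apply: (@continuous_max _ _ (cst 0) (fun t => Num.min t d)).
  exact: cst_continuous.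
by apply: (@continuous_min _ _ id (cst d)); [exact: cvg_id|exact: cst_continuous].
Qed.

Lemma clamp_itv d t : 0 <= d -> 0 <= clamp d t <= d.
Proof. by move=> d0; rewrite /clamp le_max lexx ge_max d0 ge_min lexx orbT. Qed.

Lemma clamp_id d t : 0 <= t <= d -> clamp d t = t.
Proof. by move=> /andP[t0 td]; rewrite /clamp min_l// max_r. Qed.

(** A unit of time is covered by [k] steps of length at most [d], each moving the lift by less than
    1/4. *)
Lemma lift_variation : exists V : R, forall w f, is_lift g w f ->
  forall s t, 0 <= t <= 1 -> `|f (s + t) - f s| <= V.
Proof.
have [d d0 dP] := orbit_modulus.
pose k := (Num.trunc d^-1).+1; exists (k%:R / 4) => w f [fc fg] s t t01.
have d_ge0 := ltW d0.
have step s' t' : 0 <= t' <= d -> `|f (s' + t') - f s'| < 1 / 4.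
  (* Clamping the increment to [0, d] gives a function on the whole line, as [near_int_confined]
     requires. *)
  move=> t'd; pose h x := f (s' + clamp d x) - f s'.
  have -> : f (s' + t') - f s' = h t' by rewrite /h clamp_id.
  apply: near_int_confined => //.
  - move=> x; apply: cvgB; last exact: cvg_cst.
    apply: continuous_comp; last exact: fc.
    by apply: cvgD; [exact: cvg_cst|exact: clamp_continuous].
  - lra.
  - move=> x; apply: close_pi; rewrite !fg; apply: dP.
    have := @clamp_itv d x d_ge0; rewrite opprD addrA subrr sub0r normrN.
    by move=> /andP[x0 xd]; rewrite ger0_norm.
  - by rewrite /h clamp_id ?lexx// addr0 subrr normr0; lra.
have tk : 0 <= t <= k%:R * d.
  have /andP[-> t1] := t01; rewrite (le_trans t1)// -ler_pdivrMr// mul1r ltW//.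
  exact: truncnS_gt.
elim: k t {t01} tk => [|k IH] t tk.
  have -> : t = 0 by move: tk; lra.
  by rewrite addr0 subrr normr0 mul0r.
have [td|dt] := leP t d.
  apply: le_trans (ltW (step s t _)) _; first by move: tk => /andP[-> _].
  by rewrite ler_pM2r// ler1n.
have := IH (t - d); rewrite subr_ge0 (ltW dt) lerBlDr.
rewrite -natr1 mulrDl mul1r in tk * => /(_ (andP tk).2).
have := step (s + (t - d)) d; rewrite lexx d_ge0 -addrA subrK => /(_ isT).
move=> h1 h2; have := ler_distD (f (s + (t - d))) (f (s + t)) (f s).
by move: h1 h2; lra.
Qed.

(** Near-covering of the compact product, run along M -> infinity, makes the size of the cylinders
    uniform. *)
Lemma close_agree : exists M, forall v w, agree M v w ->
  forall s, 0 <= s <= 1 -> close (1 / 8) (g (v, s)) (g (w, s)).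
Proof.
pose P M (p : fib_space * R) :=
  forall v, agree M v p.1 -> close (1 / 8) (g (v, p.2)) (g p).
have /compact_near_coveringP Knc := compact_setX fib_compact (@segment_compact R 0 1).
have : \forall M \near \oo, ([set: fib_space] `*` `[0, 1]) `<=` P M.
  apply: Knc => -[w s] _.
  have e0 : 0 < 1 / 16 :> R by [].
  have [[A B] [/= nA nB] AB] := gc (nbhs_close (g (w, s)) e0).
  have [M MA] := nbhs_agree nA.
  exists (([set v | agree M v w] `*` B), [set N | (M <= N)%N]) => /=.
    split; last by exists M.
    by exists ([set v | agree M v w], B) => //; split => //; exact: nbhs_agreeE.
  move=> [[v t] N] /= [[vw Bt] MN] u /= uv.
  apply: (@close_le _ (1 / 16 + 1 / 16)); first lra.
  apply: (@close_trans _ _ _ _ (g (w, s))); last first.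
    by apply: (AB (v, t)); split => //; exact: MA.
  apply/close_sym/(AB (u, t)); split => //; apply: MA => n nM.
  by rewrite uv ?vw// (leq_trans nM).
case=> M _ MP; exists M => v w vw s s01.
apply: (MP M (leqnn M) (w, s)) vw; by split => //=; rewrite in_itv.
Qed.

(** The difference of the lifts stays within 1/8 of one fixed integer during the unit of time. *)
Lemma lift_agree v w f f' :
  (forall s, 0 <= s <= 1 -> close (1 / 8) (g (v, s)) (g (w, s))) ->
  is_lift g v f -> is_lift g w f' ->
  `|(f' 1 - f' 0) - (f 1 - f 0)| < 1 / 4.
Proof.
move=> vw [fc fg] [f'c f'g].
have : close (1 / 8) (circle_pi (f 0)) (circle_pi (f' 0)).
  by rewrite fg f'g; apply: vw; rewrite lexx ler01.
move=> /close_pi[n n8].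
pose h x := f' (clamp 1 x) - f (clamp 1 x) - n%:~R.
have h8 x : `|h x| < 1 / 8.
  apply: near_int_confined; [|lra| |].
  - move=> y; apply: cvgB; last exact: cvg_cst.
    apply: cvgB.
      by apply: continuous_comp; [exact: clamp_continuous|exact: f'c].
    by apply: continuous_comp; [exact: clamp_continuous|exact: fc].
  - move=> y.
    have : close (1 / 8) (circle_pi (f (clamp 1 y))) (circle_pi (f' (clamp 1 y))).
      by rewrite fg f'g; apply: vw; exact: clamp_itv.
    by move=> /close_pi[m m8]; exists (m - n); rewrite /h intrB opprB addrA subrK.
  - by rewrite /h clamp_id// lexx ler01.
have := h8 1; rewrite /h clamp_id ?lexx ?ler01//; move: n8.
by rewrite !ltr_norml; lra.
Qed.

End equivariant_map.
End rotation.

(** * Existence and stability of rotation numbers *)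

Section rotation_number.
Context (R : realType) (g : fib_space * R -> circle R).
Hypotheses (gc : continuous g) (geq : equivariant g).
Local Notation T := fib_shift.

(** Points with the same central block share one reference value, from which each deviates by less
    than 1/8. *)
Lemma fiber_lift M :
  (forall v w, agree M v w ->
    forall s, 0 <= s <= 1 -> close (1 / 8) (g (v, s)) (g (w, s))) ->
  exists theta : fib_space -> R, [/\ forall w, circle_pi (theta w) = g (w, 0),
    forall w, `|theta w| <= 2 &
    forall v w, agree M v w -> `|theta v - theta w| < 1 / 4].
Proof.
move=> MP.
(* For a block that occurs nowhere this is the default point; later only blocks [win w] are used. *)
pose rep u := get [set v : fib_space | window (set_val v) (- M%:Z) M.*2.+1 = u].
pose win (w : fib_space) := window (set_val w) (- M%:Z) M.*2.+1.
have repP w : agree M (rep (win w)) w.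
  apply/agreeP.
  exact: (@getPex _ [set v : fib_space | win v = win w] (ex_intro _ w erefl)).
have /choice[th0 th0P] : forall u, exists x, circle_pi x = g (rep u, 0) /\ 0 <= x < 1.
  by move=> u; have [x ? ?] := circle_pi01 (g (rep u, 0)); exists x.
(* The lift of [g (w, 0)] closest to a lift chosen for the central block of w. *)
have /choice[th thP] : forall w, exists x,
    circle_pi x = g (w, 0) /\ `|x - th0 (win w)| < 1 / 8.
  move=> w; have : close (1 / 8) (circle_pi (th0 (win w))) (g (w, 0)).
    by rewrite (th0P _).1; apply: MP; rewrite ?lexx ?ler01.
  move=> /close_pil[d dg d8]; exists (th0 (win w) + d).
  by rewrite addrAC subrr add0r.
exists th; split=> [w|w|v w /agreeP vw]; first exact: (thP w).1.
  have := (th0P (win w)).2; have := (thP w).2; rewrite ltr_norml ler_norml; lra.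
have := (thP v).2; have := (thP w).2; rewrite [win v]vw !ltr_norml; lra.
Qed.

Lemma lift_translate w f (n : nat) : is_lift g w f ->
  is_lift g (fib_translate n w) (fun t => f (n%:R + t)).
Proof.
move=> [fc fg]; split.
  move=> t; apply: continuous_comp; last exact: fc.
  by apply: cvgD; [exact: cvg_cst|exact: cvg_id].
by move=> t; rewrite fg equivariant_translate// addrC.
Qed.

(* Up to the coboundary of theta, the increments of the lifts over unit time are
   integers, hence locally constant functions of the point. *)
Lemma lift_cocycle : exists M (nu : seq bool -> int) (theta : fib_space -> R),
  (forall w, `|theta w| <= 2) /\
  forall w f, is_lift g w f -> forall N : nat,
    f N%:R - f 0 =
      (nsum (fun i => nu (window (set_val w) (i%:Z - M%:Z) M.*2.+1)) N)%:~R
      + theta (fib_translate N w) - theta w.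
Proof.
have [M MP] := close_agree gc; have [th [thg th2 thM]] := fiber_lift MP.
have intP w f : is_lift g w f ->
    exists n : int, f 1 - f 0 = n%:~R + th (T w) - th w.
  move=> [fc fg].
  have /circle_piP[a aE] : circle_pi (th (T w)) = circle_pi (f 1).
    by rewrite thg fg geq add0r.
  have /circle_piP[b bE] : circle_pi (th w) = circle_pi (f 0) by rewrite thg fg.
  by exists (a - b); rewrite aE bE intrB; ring.
(* Radius [M.+1] ensures agreement to radius [M] for the points and for their shifts. Three
   differences below 1/4 then force the integers to coincide. *)
have intM v w f f' n n' : agree M.+1 v w -> is_lift g v f -> is_lift g w f' ->
    f 1 - f 0 = n%:~R + th (T v) - th v ->
    f' 1 - f' 0 = n'%:~R + th (T w) - th w -> n = n'.
  move=> vw fv f'w nE n'E.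
  have vw' : agree M v w by exact: agree_le vw.
  have := thM _ _ (agree_translate vw); have := thM _ _ vw'.
  have := lift_agree (MP _ _ vw') fv f'w; rewrite nE n'E => h1 h2 h3.
  apply/eqP; rewrite -subr_eq0; apply/eqP/(@intr_lt1_eq0 R).
  by move: h1 h2 h3; rewrite intrB !ltr_norml; lra.
have /choice[n nP] : forall w, exists n : int, forall f, is_lift g w f ->
    f 1 - f 0 = n%:~R + th (T w) - th w.
  move=> w; have [f0 f0w] := lift_exists gc geq w; have [n nE] := intP _ _ f0w.
  exists n => f fw; have [n' n'E] := intP _ _ fw.
  by rewrite (@intM w w _ _ n n' _ f0w fw nE n'E).
have nM v w : agree M.+1 v w -> n v = n w.
  move=> vw; have [f fv] := lift_exists gc geq v.
  have [f' f'w] := lift_exists gc geq w.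
  exact: (intM _ _ _ _ _ _ vw fv f'w (nP _ _ fv) (nP _ _ f'w)).
pose win (w : fib_space) := window (set_val w) (- M.+1%:Z) M.+1.*2.+1.
(* By [nM] the integer does not depend on the point chosen in the cylinder. *)
pose nu u := n (get [set v : fib_space | win v = u]).
have nuE w : nu (win w) = n w.
  apply: nM; apply/agreeP.
  exact: (@getPex _ [set v : fib_space | win v = win w] (ex_intro _ w erefl)).
exists M.+1, nu, th; split => // w f fw; elim=> [|N IH].
  by rewrite fib_translate0 [nsum _ 0]big_geq// add0r !subrr.
rewrite nsumS intrD.
have := nP _ _ (lift_translate N fw); rewrite addr0 natr1 -nuE.
have -> : win (fib_translate N w) = window (set_val w) (N%:Z - M.+1%:Z) M.+1.*2.+1.
  apply: eq_map => i.
  by rewrite [LHS]/(set_val w (- M.+1%:Z + i%:Z + N%:Z)); congr (set_val w); lia.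
rewrite [T _]fib_translateD (_ : 1 + N%:Z = N.+1%:Z); last by lia.
by move=> fN; rewrite -(subrK (f N%:R) (f N.+1%:R)) -addrA IH fN; ring.
Qed.

(** Block sums along any orbit are differences of block sums along x, so [p] and [q] do not depend
    on the orbit. *)
Lemma rotation_exists : exists p q : int,
  rotation g (p%:~R + q%:~R * (1 - golden R)).
Proof.
have [M [nu [th [th2 fE]]]] := lift_cocycle.
have [V VP] := lift_variation gc geq.
pose L := M.*2.+1; have [p [q [B BP]]] := nsum_fib_block_bounded nu L.
exists p, q; set c := (X in rotation _ X).
(* The terms come from two block sums, two discrepancies of at most 2 in the number of ones, and two
   values of [th]. *)
have natP w f : is_lift g w f -> forall N : nat,
    `|f N%:R - f 0 - c * N%:R| <= (2 * B)%:~R + `|q%:~R| * 4 + 4.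
  move=> fw N; rewrite (fE _ _ fw).
  have [i0 wE] := @fib_set_fib_seq _ (- M%:Z) (N + L) (set_mem (valP w)).
  pose S := nsum (nu \o fib_block L).
  have -> : nsum (fun i => nu (window (set_val w) (i%:Z - M%:Z) M.*2.+1)) N =
      S (i0 + N)%N - S i0.
    rewrite /S nsumD addrAC subrr add0r; apply: eq_nsum => i iN /=; congr nu.
    apply/eq_in_map => l; rewrite mem_iota add0n => /andP[_ lL].
    rewrite -addnA -wE -/(set_val _); last by rewrite /L; lia.
    by congr (set_val w); lia.
  have BR i : `|(S i)%:~R - (p%:~R * i%:R + q%:~R * (fib_ones i)%:~R)| <= B%:~R :> R.
    by have := BP i; rewrite -(ler_int R) intr_norm intrB intrD !intrM.
  pose X i : R := (fib_ones i)%:~R - (1 - golden R) * i%:R.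
  have X2 i : `|X i| <= 2 by exact: fib_ones_bounded.
  have qX : `|q%:~R * (X (i0 + N)%N - X i0)| <= `|q%:~R| * 4.
    rewrite normrM ler_wpM2l//; have := X2 i0; have := X2 (i0 + N)%N.
    by rewrite !ler_norml; lra.
  have := BR i0; have := BR (i0 + N)%N; have := th2 w; have := th2 (fib_translate N w).
  move: qX; rewrite /X /c natrD intrB intrM.
  move: (`|q%:~R| * 4) => Q; rewrite !ler_norml; lra.
(* The last two summands account for the fractional part of [t]. *)
exists ((2 * B)%:~R + `|q%:~R| * 4 + 4 + V + `|c|) => w f fw t t0.
pose N := Num.trunc t.
have tN : 0 <= t - N%:R <= 1.
  by rewrite subr_ge0 truncn_le t0/= lerBlDl natr1 ltW// truncnS_gt.
have := natP w f fw N; have := VP w f fw N%:R (t - N%:R) tN; rewrite subrKC.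
have : `|c * (t - N%:R)| <= `|c|.
  by rewrite normrM ler_piMr// ger0_norm; case/andP: tN.
rewrite mulrBr; move: (_ + _ * 4 + 4) => K; rewrite !ler_norml; lra.
Qed.

(** Lifts of close maps keep within 1/4 of a fixed integer distance, which changes the deviation by
    less than 1. *)
Lemma rotation_close (g' : fib_space * R -> circle R) c :
  (forall w s, close (1 / 4) (g (w, s)) (g' (w, s))) -> rotation g c -> rotation g' c.
Proof.
move=> gg' [C CP]; exists (C + 1) => w f' [f'c f'g] t t0.
have [f fw] := lift_exists gc geq w; have [fc fg] := fw.
have : close (1 / 4) (circle_pi (f 0)) (circle_pi (f' 0)) by rewrite fg f'g.
move=> /close_pi[n n4].
have := CP w f fw t t0.
have : `|f' t - f t - n%:~R| < 1 / 4.
  apply: (near_int_confined (h := fun t => f' t - f t - n%:~R)) => //.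
  - by move=> s; apply: cvgB; [apply: cvgB; [exact: f'c|exact: fc]|exact: cvg_cst].
  - lra.
  - move=> s; have : close (1 / 4) (circle_pi (f s)) (circle_pi (f' s)) by rewrite fg f'g.
    by move=> /close_pi[m m4]; exists (m - n); rewrite intrB opprB addrA subrK.
by move: n4; rewrite !ltr_norml !ler_norml; lra.
Qed.

End rotation_number.

(** * The Schwartzman homomorphism *)

Section winding.
Context (R : realType).
Local Notation X := (suspension R fib_shift).

Definition pull (phi : X -> circle R) (p : fib_space * R) : circle R :=
  phi (susp_pi fib_shift p.1 p.2).

Lemma susp_pi_continuous :
  continuous (fun p : fib_space * R => susp_pi fib_shift p.1 p.2).
Proof.
have -> : (fun p : fib_space * R => susp_pi fib_shift p.1 p.2) =
    \pi_{eq_quot susp_equiv R fib_shift} by apply/funext => -[w s].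
exact: pi_continuous.
Qed.

Lemma susp_pi_shift (w : fib_space) (s : R) :
  susp_pi fib_shift (fib_shift w) s = susp_pi fib_shift w (s + 1).
Proof. by apply/esym/eqmodP/asboolP; exists 1; rewrite /= addrK. Qed.

Lemma susp_pi_surj (x : X) : exists w s, x = susp_pi fib_shift w s.
Proof.
pose p := repr (x : {eq_quot susp_equiv R fib_shift}); exists p.1, p.2.
by rewrite /susp_pi -surjective_pairing reprK.
Qed.

Lemma pull_continuous phi : continuous phi -> continuous (pull phi).
Proof.
by move=> phic p; apply: continuous_comp; [exact: susp_pi_continuous|exact: phic].
Qed.

Lemma pull_equivariant phi : equivariant (pull phi).
Proof. by move=> w s; rewrite /pull /= susp_pi_shift. Qed.

Lemma bounded_div_cvg0 (h : R -> R) (K t0 : R) :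
  (forall t, t0 <= t -> `|h t| <= K) -> h t / t @[t --> +oo] --> 0.
Proof.
move=> hK; apply/cvgrPdist_lt => e e0; near=> t.
have t1 : 0 < t by near: t; exact: nbhs_pinfty_gt (num_real _).
rewrite sub0r normrN normrM normfV (gtr0_norm t1) ltr_pdivrMr//.
apply: le_lt_trans (hK t _) _; first by near: t; exact: nbhs_pinfty_ge (num_real _).
by rewrite mulrC -ltr_pdivrMr//; near: t; exact: nbhs_pinfty_gt (num_real _).
Unshelve. all: by end_near. Qed.

Lemma rotation_winding phi c : continuous phi -> rotation (pull phi) c ->
  forall x, has_winding phi x c.
Proof.
move=> phic [C CP] x; have [w [s ->]] := susp_pi_surj x.
have [f fw] := lift_exists (pull_continuous phic) (@pull_equivariant phi) w.
have [fc fg] := fw; exists (fun t => f (s + t)).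
  split; last by move=> t; rewrite susp_flowE fg.
  move=> t; apply: continuous_comp; last exact: fc.
  by apply: cvgD; [exact: cvg_cst|exact: cvg_id].
have h0 : (f (s + t) - c * t) / t @[t --> +oo] --> 0.
  (* The threshold - s ensures s + t >= 0, the range of the rotation estimate. *)
  apply: (@bounded_div_cvg0 _ (C + `|f 0| + `|c * s|) (- s)) => t st.
  have := CP w f fw (s + t); rewrite -lerBlDl sub0r => /(_ st).
  have := ler_norm (f 0); have := ler_norm (- f 0).
  have := ler_norm (c * s); have := ler_norm (- (c * s)).
  by rewrite !normrN !ler_norml; lra.
have : (f (s + t) - c * t) / t + c @[t --> +oo] --> c.
  by rewrite -[X in _ --> X]add0r; apply: cvgD h0 _; exact: cvg_cst.
apply: cvg_trans; apply: near_eq_cvg; near=> t => /=.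
have t1 : 0 < t by near: t; exact: nbhs_pinfty_gt (num_real _).
by rewrite mulrBl mulfK ?gt_eqF// subrK.
Unshelve. all: by end_near. Qed.

(** Two lifts along one orbit have bounded difference, so their averages share a limit. *)
Lemma has_winding_unique phi (x : X) (c c' : R) :
  has_winding phi x c -> has_winding phi x c' -> c' = c.
Proof.
move=> [f [fc fg] fl] [f' [f'c f'g] f'l].
have /circle_piP[n n0] : circle_pi (f 0) = circle_pi (f' 0) by rewrite fg f'g.
have h4 t : `|f' t - f t - n%:~R| < 1 / 4.
  apply: (near_int_confined (h := fun t => f' t - f t - n%:~R)).
  - by move=> s; apply: cvgB; [apply: cvgB; [exact: f'c|exact: fc]|exact: cvg_cst].
  - lra.
  - move=> s; have /circle_piP[m ->] : circle_pi (f s) = circle_pi (f' s) by rewrite fg f'g.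
    by exists (m - n); rewrite intrB (_ : _ - _ = 0) ?normr0//; ring.
  - by rewrite n0 (_ : _ - _ = 0) ?normr0//; ring.
have h0 : (f' t - f t) / t @[t --> +oo] --> (0 : R).
  apply: (@bounded_div_cvg0 _ (`|n%:~R| + 1) 0) => t _.
  have := h4 t; have := ler_norm (n%:~R : R); have := ler_norm (- n%:~R : R).
  by rewrite normrN !ltr_norml ler_norml; lra.
have hcc : (f' t - f t) / t @[t --> +oo] --> c' - c.
  under eq_fun do rewrite mulrBl; exact: cvgB f'l fl.
by apply/eqP; rewrite -subr_eq0 -(cvg_lim _ hcc)// (cvg_lim _ h0).
Qed.

(** By compactness the homotopy splits into finitely many steps, each 1/4-close on all orbits, and
    [rotation_close] crosses each step. *)
Lemma homotopic_rotation (phi psi : X -> circle R) c :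
  homotopic R phi psi -> rotation (pull phi) c -> rotation (pull psi) c.
Proof.
move=> [H [Hc H0 H1]].
(* Clamping the parameter turns continuity within [0, 1] into continuity on the whole product. *)
pose G (q : (fib_space * R) * R) : circle R :=
  H (susp_pi fib_shift q.1.1 q.1.2, clamp 1 q.2).
have Gc : continuous G.
  pose j (q : (fib_space * R) * R) : X * R :=
    (susp_pi fib_shift q.1.1 q.1.2, clamp 1 q.2).
  have jc : continuous j.
    apply: continuous_pair => q.
      apply: (@continuous_comp _ _ _ fst (fun p => susp_pi fib_shift p.1 p.2)).
        exact: cvg_fst.
      exact: susp_pi_continuous.
    by apply: (@continuous_comp _ _ _ snd (clamp 1));
      [exact: cvg_snd|exact: clamp_continuous].
  have jA q : [set p : X * R | p.2 \in `[0, 1]] (j q).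
    by rewrite /= in_itv; exact: clamp_itv.
  move=> q U; have /subspace_continuousP/(_ (j q) (jA q)) HU := Hc.
  move=> /HU /= /jc; rewrite /= nbhs_simpl /=; apply: filterS => q' /=.
  by apply; exact: jA.
have Grc r : continuous (fun p => G (p, r)).
  move=> p; apply: (@continuous_comp _ _ _ (fun p => (p, r)) G); last exact: Gc.
  by apply: continuous_pair => ?; [exact: cvg_id|exact: cvg_cst].
have Geq r : equivariant (fun p => G (p, r)).
  by move=> w s; rewrite /G /= susp_pi_shift.
have e0 : 0 < 1 / 4 :> R by [].
have K01 := @segment_compact R 0 1.
have [d d0 dP] :=
  compact_modulus (compact_setX (compact_setX fib_compact K01) K01) Gc e0.
have dG r r' w s : 0 <= r <= 1 -> `|r - r'| <= d ->
    close (1 / 4) (G ((w, s), r)) (G ((w, s), r')).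
  move=> r01 rr'; rewrite -[s](subrK (Num.floor s)%:~R).
  rewrite -(equivariant_translate (Geq r)) -(equivariant_translate (Geq r')).
  apply: dP => //; split; last by rewrite /= in_itv.
  by split => //=; rewrite in_itv; exact: frac_itv.
have clampS (k : nat) : `|clamp 1 (k%:R * d) - clamp 1 (k.+1%:R * d)| <= d.
  rewrite -natr1 mulrDl mul1r; have : 0 <= k%:R * d by rewrite mulr_ge0// ltW.
  move: (k%:R * d) => D D0.
  by rewrite /clamp /Num.max /Num.min; do 4? case: ifPn => //; rewrite -?leNgt ler_norml; lra.
have pull0 : pull phi = fun p => G (p, clamp 1 (0%:R * d)).
  by apply/funext => p; rewrite /G /= mul0r !clamp_id ?lexx ?ler01// H0.
pose k := (Num.trunc d^-1).+1.
have k1 : clamp 1 (k%:R * d) = 1.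
  have : 1 <= k%:R * d by rewrite -ler_pdivrMr// mul1r ltW// truncnS_gt.
  by rewrite /clamp => kd; rewrite min_r// max_r.
have -> : pull psi = fun p => G (p, clamp 1 (k%:R * d)).
  by apply/funext => p; rewrite /G k1 /= clamp_id ?lexx ?ler01// H1.
rewrite pull0; elim: k {k1} => // k IH /IH.
apply: (rotation_close (Grc _) (Geq _)) => w s.
by apply: dG; [exact: clamp_itv|exact: clampS].
Qed.

Lemma homotopic_refl (phi : X -> circle R) : continuous phi -> homotopic R phi phi.
Proof.
move=> phic; exists (phi \o fst); split => //.
apply: continuous_subspaceT => p.
by apply: continuous_comp; [exact: cvg_fst|exact: phic].
Qed.

(** * The value on a homotopy class *)

Section schwartzman_value.
Context (mu : probability (borel fib_space) R).

Lemma susp_measure0 : @susp_measure R fib_space fib_shift mu set0 = 0%E.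
Proof.
rewrite /susp_measure; apply: integral0_eq => s _; apply: integral0_eq => w _.
by rewrite indicE in_set0.
Qed.

Lemma susp_measureT : @susp_measure R fib_space fib_shift mu setT = 1%E.
Proof.
rewrite /susp_measure (eq_integral (cst 1%E)) => [|s _].
  by rewrite integral_cst//= lebesgue_measure_itv/= lte_fin ltr01 sube0 mule1.
rewrite (eq_integral (cst 1%E)) => [|w _]; last by rewrite indicE in_setT.
by rewrite integral_cst// mul1e; exact: probability_setT.
Qed.

(** Every representative has winding [c] on all orbits, so the empty exceptional set serves.
    Conversely a null set is not the whole space, so any other admissible value is attained at some
    point and equals [c]. *)
Lemma schwartzmanE phi c : continuous phi -> rotation (pull phi) c ->
  schwartzman mu (@homotopy_class R X (circle R) phi) = c.
Proof.
move=> phic rc.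
apply: get_unique => [psi [psic /homotopic_rotation/(_ rc) psir]|y /(_ phi)].
  exists set0; split; [exact: measurable0|exact: susp_measure0|].
  by move=> x /=; apply; exact: rotation_winding.
move=> /(_ (conj phic (homotopic_refl phic)))[A [_ A0 yA]].
have [x yx] : exists x, has_winding phi x y.
  apply: contrapT => nyx.
  have AT : A = setT by rewrite -subTset => x _; apply: yA => yx; apply: nyx; exists x.
  by have := susp_measureT; rewrite -AT A0 => /eqP; rewrite eqe eq_sym oner_eq0.
exact: has_winding_unique (rotation_winding phic rc x) yx.
Qed.

End schwartzman_value.
End winding.

(** * Realization *)

Section realization.
Context (R : realType).
Local Notation X := (suspension R fib_shift).

(* On [n, n + 1] the map climbs p + q w(n) times around the circle, so its
   lifts count the ones of w with weight q. *)
Definition count_map (p q : int) (z : fib_space * R) : circle R :=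
  circle_pi (p%:~R * z.2 + q%:~R * (z.2 - (Num.floor z.2)%:~R)
    * (set_val z.1 (Num.floor z.2) : nat)%:R).

(** At c = 1 the floor jumps to n + 1, but the two formulas differ by the integer q w(n); hence the
    closed interval. *)
Lemma count_mapE p q w (n : int) (c : R) : 0 <= c <= 1 ->
  count_map p q (w, n%:~R + c) =
  circle_pi (p%:~R * (n%:~R + c) + q%:~R * c * (set_val w n : nat)%:R).
Proof.
move=> /andP[c0]; rewrite le_eqVlt => /predU1P[->|c1].
  rewrite /count_map/= -[1]/(1%:~R) -intrD floorK ?intr_int// intrKfloor.
  rewrite subrr mulr0 mul0r addr0.
  apply/circle_piP; exists (q * (set_val w n : nat)%:Z).
  by rewrite mulr1 intrM.
have nE : Num.floor (n%:~R + c) = n.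
  by apply/floor_def; rewrite lerDl c0/= intrD1 ltrD2l.
by rewrite /count_map/= nE addrAC subrr add0r.
Qed.

Lemma count_map_equivariant p q : equivariant (count_map p q).
Proof.
move=> w s; rewrite -[s](subrKC (Num.floor s)%:~R); set c := s - _.
have c01 : 0 <= c <= 1 by exact: frac_itv.
rewrite addrAC -[1 in RHS]/(1%:~R) -intrD !count_mapE//.
apply/circle_piP; exists p; rewrite [set_val (fib_shift w) _]/(set_val w (_ + 1)).
by rewrite intrD; ring.
Qed.

Lemma count_map_continuous p q : continuous (count_map p q).
Proof.
move=> [w0 s0]; pose k := Num.floor s0.
pose b n : R := (set_val w0 n : nat)%:R.
(* A real lift near [s0]: each clamp lets the contribution of one letter climb to its full value and
   stay there, so the two unit intervals meeting at [k] share one continuous formula. *)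
pose G (s : R) := p%:~R * s +
  q%:~R * (clamp 1 (s - (k - 1)%:~R) * b (k - 1) + clamp 1 (s - k%:~R) * b k).
have Gc : continuous G.
  have cc (n : int) : continuous (fun s : R => clamp 1 (s - n%:~R)).
    move=> s; apply: (@continuous_comp _ _ _ (fun s : R => s - n%:~R) (clamp 1));
      last exact: clamp_continuous.
    by apply: cvgB; [exact: cvg_id|exact: cvg_cst].
  move=> s; apply: cvgD; first by apply: cvgM; [exact: cvg_cst|exact: cvg_id].
  apply: cvgM; first exact: cvg_cst.
  by apply: cvgD; apply: cvgM; [exact: cc|exact: cvg_cst|exact: cc|exact: cvg_cst].
have sk s : `|s - k%:~R| < 1 -> forall w, set_val w (k - 1) = set_val w0 (k - 1) ->
    set_val w k = set_val w0 k -> count_map p q (w, s) = circle_pi (G s).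
  move=> sk1 w wk1 wk; have [ks|/ltW sk] := leP k%:~R s.
    have c01 : 0 <= s - k%:~R <= 1.
      by move: sk1; rewrite ltr_norml; lra.
    rewrite -[s in LHS](subrKC k%:~R) count_mapE// subrKC wk /G.
    rewrite [clamp _ (s - k%:~R)]clamp_id//.
    have -> : clamp 1 (s - (k - 1)%:~R) = 1.
      by rewrite /clamp intrB min_r ?max_r//; lra.
    apply/circle_piP; exists (q * (set_val w0 (k - 1) : nat)%:Z).
    by rewrite intrM /b; ring.
  have c01 : 0 <= s - (k - 1)%:~R <= 1.
    by move: sk1; rewrite intrB ltr_norml; lra.
  rewrite -[s in LHS](subrKC (k - 1)%:~R) count_mapE// subrKC wk1 /G.
  rewrite [clamp _ (s - (k - 1)%:~R)]clamp_id//.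
  have -> : clamp 1 (s - k%:~R) = 0.
    by rewrite /clamp min_l ?max_l//; lra.
  by congr circle_pi; rewrite /b; ring.
have s0k : `|s0 - k%:~R| < 1.
  have := floor_le_tmp s0; have := floorD1_gt s0; rewrite -/k intrD1 => ? ?.
  by rewrite ger0_norm; lra.
move=> U; rewrite /= sk// => GU.
have GsU : \forall s \near s0, U (circle_pi (G s)).
  apply: (@continuous_comp _ _ _ G (@circle_pi R)) GU; first exact: Gc.
  exact: circle_pi_continuous.
pose A := [set w : fib_space | set_val w (k - 1) = set_val w0 (k - 1)] `&`
  [set w | set_val w k = set_val w0 k].
exists (A, [set s | U (circle_pi (G s)) /\ `|s - k%:~R| < 1]).
  split => /=; first by apply: filterI; exact: nbhs_coord.
  apply: filterI => //; near=> s.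
  have : `|s0 - s| < 1 - `|s0 - k%:~R| by near: s; apply: near_dist; rewrite subr_gt0.
  by have := ler_distD s0 s k%:~R; rewrite (distrC s s0); lra.
by move=> [w s] /= [[w1 w2] [Us ?]]; rewrite sk.
Unshelve. all: by end_near. Qed.

Lemma iterz_fib_shift (n : int) w : iterz fib_shift n w = fib_translate n w.
Proof.
elim/int_ind: n => [|n IH|n IH]; first by rewrite fib_translate0.
  by rewrite -addn1 PoszD iterzS IH [LHS]fib_translateD addrC.
by rewrite -addn1 PoszD opprD iterzP IH [LHS]fib_translateD addrC.
Qed.

(** Equivariance makes the value independent of the representative, and continuity passes to the
    quotient. *)
Lemma pull_surj (g : fib_space * R -> circle R) : continuous g -> equivariant g ->
  exists2 phi : X -> circle R, continuous phi & pull phi = g.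
Proof.
move=> gc geq; pose phi (x : X) := g (repr (x : {eq_quot susp_equiv R fib_shift})).
have phiE p : phi (\pi_{eq_quot susp_equiv R fib_shift} p) = g p.
  rewrite /phi; case: piP => -[w' s'] /eqmodP/asboolP[n /= [-> ->]].
  by case: p => w s; rewrite iterz_fib_shift equivariant_translate// subrK.
exists phi; last by apply/funext => -[w s]; exact: phiE.
apply/quotient_continuous => p.
by have -> : phi \o \pi_{eq_quot susp_equiv R fib_shift} = g by apply/funext.
Qed.

(** Some rotation number exists by [rotation_exists], so it suffices to identify it along one orbit
    at integer times. *)
Lemma count_map_rotation p q :
  rotation (count_map p q) (p%:~R + q%:~R * (1 - golden R)).
Proof.
have gc := @count_map_continuous p q; have geq := @count_map_equivariant p q.
have [p' [q' rot]] := rotation_exists gc geq.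
set c := (X in rotation _ X); suff -> : c = p'%:~R + q'%:~R * (1 - golden R) by [].
move: rot; set c' := (X in rotation _ X) => -[C CP].
(* The base point continues to the right of 0 as the infinite word x, so its ones are counted by
   [fib_ones]. *)
pose w : fib_space := point.
have [f fw] := lift_exists gc geq w; have [fc fg] := fw.
have fE (N : nat) : f N%:R - f 0 = p%:~R * N%:R + q%:~R * (fib_ones N)%:~R.
  elim: N => [|N IH]; first by rewrite /fib_ones [nsum _ 0]big_geq// !mulr0 addr0 subrr.
  pose b : R := (fib_seq N : nat)%:R.
  pose h t := f (N%:R + clamp 1 t) - f N%:R - (p%:~R * clamp 1 t + q%:~R * clamp 1 t * b).
  have liftE t : 0 <= t <= 1 -> exists n : int,
      f (N%:R + t) = p%:~R * (N%:R + t) + q%:~R * t * b + n%:~R.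
    move=> t01; apply/circle_piP.
    by rewrite fg -[N%:R]/(N%:~R) count_mapE.
  have h0 : h 0 = 0 by rewrite /h clamp_id ?lexx ?ler01// addr0; ring.
  (* Since [h] takes integer values and starts at 0, it is confined below every small [e], hence
     vanishes at 1. *)
  have h1 e : 0 < e <= 1 / 2 -> `|h 1| < e.
    move=> /andP[e0 e2]; apply: near_int_confined => //.
    - have cN : continuous (fun t => f (N%:R + clamp 1 t)).
        move=> t; apply: continuous_comp; last exact: fc.
        by apply: cvgD; [exact: cvg_cst|exact: clamp_continuous].
      move=> t; apply: cvgB; first by apply: cvgB; [exact: cN|exact: cvg_cst].
      apply: cvgD; first by apply: cvgM; [exact: cvg_cst|exact: clamp_continuous].
      apply: cvgM; last exact: cvg_cst.
      by apply: cvgM; [exact: cvg_cst|exact: clamp_continuous].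
    - move=> t; have [m mE] := liftE _ (clamp_itv t ler01).
      have [|n nE] := liftE 0; first by rewrite lexx ler01.
      rewrite addr0 in nE; exists (m - n).
      by rewrite /h mE nE intrB (_ : _ - _ = 0) ?normr0//; ring.
    - by rewrite h0 normr0.
  have hz : h 1 = 0.
    apply/eqP; rewrite -normr_le0; apply/ler_addgt0Pl => e e0; rewrite addr0.
    have [e2|/ltW e2] := leP e (1 / 2); first by apply/ltW/h1; rewrite e0.
    by apply: le_trans e2; apply/ltW/h1; lra.
  move: hz; rewrite /h clamp_id ?lexx ?ler01// natr1.
  move=> /eqP; rewrite subr_eq0 => /eqP fN.
  rewrite -(subrK (f N%:R) (f N.+1%:R)) fN -addrA IH /fib_ones nsumS intrD -natr1.
  by rewrite -/fib_ones -[((fib_seq N : nat)%:Z)%:~R]/b; ring.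
have ub (N : nat) : N%:R * `|c - c'| <= C + `|q%:~R| * 2.
  have := CP w f fw N%:R (ler0n _ _); rewrite fE.
  have : `|q%:~R * ((fib_ones N)%:~R - (1 - golden R) * N%:R)| <= `|q%:~R| * 2.
    by rewrite normrM ler_wpM2l// fib_ones_bounded.
  rewrite -[X in X * `|_|]ger0_norm// -normrM.
  have -> : N%:R * (c - c') = (p%:~R * N%:R + q%:~R * (fib_ones N)%:~R - c' * N%:R)
     - q%:~R * ((fib_ones N)%:~R - (1 - golden R) * N%:R) by rewrite /c; ring.
  by move=> h1 h2; rewrite (le_trans (ler_normB _ _))// lerD.
apply/eqP; rewrite -subr_eq0 -normr_eq0 eq_le normr_ge0 andbT leNgt; apply/negP => cc.
have := ub (Num.trunc ((C + `|q%:~R| * 2) / `|c - c'|)).+1.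
by rewrite -ler_pdivlMr// leNgt truncnS_gt.
Qed.

End realization.

(** * The ring Z[alpha] and the range of the homomorphism *)

Lemma int_adjoin_golden (R : realType) :
  int_adjoin (golden R) =
  [set x | exists p q : int, x = p%:~R + q%:~R * (1 - golden R)].
Proof.
have g2 := golden_sqr R.
rewrite eqEsubset; split.
  apply: smallest_sub; last first.
    move=> x [[n _ <-]|->]; first by exists n, 0; rewrite mul0r addr0.
    by exists 1, (-1); ring.
  split.
  - by apply/mem_set; exists 1, 0; rewrite mul0r addr0.
  - move=> x y /set_mem[p [q ->]] /set_mem[p' [q' ->]]; apply/mem_set.
    by exists (p - p'), (q - q'); rewrite !intrB; ring.
  - move=> x y /set_mem[p [q ->]] /set_mem[p' [q' ->]]; apply/mem_set.
    (* With b = 1 - alpha, the relation alpha^2 = 1 - alpha gives b^2 = 3 b - 1. *)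
    exists (p * p' - q * q'), (p * q' + q * p' + 3 * (q * q')).
    by rewrite intrB !intrD !intrM; ring: g2.
move=> x [p [q ->]] S [[S1 SB SM] GS].
have Sint (n : int) : n%:~R \in S by apply/mem_set/GS; left; exists n.
have Sg : golden R \in S by apply/mem_set/GS; right.
(* Closure is stated for differences, so the sum is written p - (0 - q (1 - alpha)). *)
apply: set_mem; rewrite -[_ * _]opprK; apply/(SB) => //; rewrite -sub0r.
by apply/(SB); [exact: (Sint 0)|apply: SM => //; exact: SB].
Qed.

Theorem theorem7p3 (R : realType) (mu : probability (borel fib_space) R)
    (mu_ergodic : ergodic fib_shift mu) :
  schwartzman_range fib_shift mu = int_adjoin ((Num.sqrt 5 - 1) / 2 : R).
Proof.
rewrite -/(golden R) int_adjoin_golden eqEsubset; split.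
  move=> _ [_ [phi phic <-] <-].
  have [p [q rot]] := rotation_exists (pull_continuous phic) (@pull_equivariant _ phi).
  by exists p, q; exact: schwartzmanE.
move=> _ [p [q ->]].
have [phi phic phiE] :=
  pull_surj (@count_map_continuous R p q) (@count_map_equivariant R p q).
exists (@homotopy_class R _ (circle R) phi); first by exists phi.
by apply: schwartzmanE => //; rewrite phiE; exact: count_map_rotation.
Qed.
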